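(* Let $(G,R)$ be a finite rooted graph without sinks such that $t^{-1}(R)=\emptyset$, the graph $G\setminus\{R\}$ is strongly connected and non-redundant, and $G\setminus\{R\}$ is not circular. If the unfolding tree $\mathcal{T}(G,R)$ is cocompact, then $(G,R)$ admits an actual labelling.
   Context: A graph $G=(VG,EG,o,t)$ is a directed multigraph (loops and multiple edges allowed). A sink is a vertex $v$ with $o^{-1}(v)=\emptyset$. A path is an empty path $\varepsilon_v$ or a sequence $e_1\cdots e_n$ of edges with $t(e_i)=o(e_{i+1})$; $O(p),T(p)$ are its origin and terminus. A rooted graph $(G,R)$ is a graph with a vertex $R$ from which every vertex is reachable. $G\setminus\{R\}$ is obtained by deleting $R$ and its incident edges; it is strongly connected if every vertex is reachable from every other. $G\setminus\{R\}$ is circular if its vertices can be enumerated $v_0,\dots,v_{N-1}$ so that every edge of $G\setminus\{R\}$ with origin $v_i$ has terminus $v_{i+1 \bmod N}$. A rooted tree is a graph with a vertex $R$ such that every vertex has a unique path from $R$. The unfolding tree $\mathcal{T}(G,R)$ has vertices the paths $p$ with $O(p)=R$ and edges $(p,pe)$ from $p$ to $pe$ for each edge $e$ with $o(e)=T(p)$. For a rooted tree $\mathcal{T}$ with root $R$ and vertex $v$, $\mathcal{T}^v$ is obtained by reversing the edges on the path from $R$ to $v$. $\cong$ is isomorphism of directed graphs. A rooted tree is cocompact if there are a finite set $F$ and $l:V\mathcal{T}\to F$ with $l(v)=l(w)\Rightarrow\mathcal{T}^v\cong\mathcal{T}^w$. Non-edge-collapsing (n.e.c.) relation on a graph $H$: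 an equivalence relation $\sim$ on vertices and on edges, compatible with $o,t$, such that for all vertices $v\sim w$ there are bijections $\pi_{v,w}:o^{-1}(v)\to o^{-1}(w)$ with $e\sim f\iff o(e)\sim o(f)$ and $\pi_{o(e),o(f)}(e)=f$. $H$ is non-redundant if its only n.e.c. relation is equality. Multisets over $X$ have positive integer multiplicities; union adds multiplicities; $M\setminus\{x\}$ removes one copy. $t_m(o^{-1}(v))$ is the multiset of termini of edges leaving $v$ counted with the number of edges; $l(t_m(o^{-1}(v)))$ its multiset of labels. Actual labelling of $(G,R)$ with $t^{-1}(R)=\emptyset$: a finite set $X$, maps $l:VG\to X$, $l_p:VG\setminus\{R\}\to X$, and multisets $M_x$ ($x\in X$) such that for all $v\neq R$: (1) $l_p(v)\in M_{l(v)}$; (2) $l(t_m(o^{-1}(v)))=M_{l(v)}\setminus\{l_p(v)\}$; (3) $l(o(e))=l_p(v)$ for all edges $e$ with $t(e)=v$; and (4) $l(t_m(o^{-1}(R)))=M_{l(R)}$. *)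

(* Defs.v *)
From mathcomp Require Import all_boot.
From mathcomp Require Import finmap multiset.
From mathcomp Require Import boolp classical_sets functions.

Set Implicit Arguments.
Unset Strict Implicit.
Unset Printing Implicit Defensive.

Local Open Scope mset_scope.

Record graph := Graph {
  vert : eqType;
  edge : eqType;
  org : edge -> vert;
  trm : edge -> vert }.

Definition sink (G : graph) (v : vert G) : Prop :=
  forall e : edge G, org e <> v.

(* A path is represented by its origin v together with its sequence of edges,
   so that the empty path at v is (v, [::]). *)
Fixpoint is_path (G : graph) (v : vert G) (p : seq (edge G)) : bool :=
  if p is e :: p' then (org e == v) && is_path (trm e) p' else true.

Definition terminus (G : graph) (v : vert G) (p : seq (edge G)) : vert G :=
  last v [seq trm e | e <- p].

Definition is_path_to (G : graph) (v w : vert G) (p : seq (edge G)) : Prop :=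
  is_path v p /\ terminus v p = w.

Definition reachable (G : graph) (v w : vert G) : Prop :=
  exists p, is_path_to v w p.

Definition rooted (G : graph) (R : vert G) : Prop :=
  forall v, reachable R v.

Definition strongly_connected (G : graph) : Prop :=
  forall v w : vert G, reachable v w.

(* [ordS i] is [i + 1] modulo [N]. *)
Definition circular (G : graph) : Prop :=
  exists (N : nat) (v : 'I_N -> vert G),
    bijective v /\
    forall (e : edge G) (i : 'I_N), org e = v i -> trm e = v (ordS i).

Section DeleteVertex.
Variables (G : graph) (R : vert G).

Let V := {v : vert G | v != R}.
Let E := {e : edge G | (org e != R) && (trm e != R)}.

Let del_org (e : E) : V := exist _ (org (val e)) (proj1 (andP (valP e))).
Let del_trm (e : E) : V := exist _ (trm (val e)) (proj2 (andP (valP e))).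

Definition del_vertex : graph := Graph del_org del_trm.
End DeleteVertex.

Definition graph_iso (G H : graph) : Prop :=
  exists (f : vert G -> vert H) (g : edge G -> edge H),
    [/\ bijective f, bijective g &
        forall e, org (g e) = f (org e) /\ trm (g e) = f (trm e)].

(* The bijections [o^-1(v) -> o^-1(w)] are given by total maps on edges, of
   which only the restriction to [o^-1(v)] for [eqV v w] is constrained. *)
Definition nec_relation (G : graph)
    (eqV : rel (vert G)) (eqE : rel (edge G)) : Prop :=
  [/\ equivalence_rel eqV, equivalence_rel eqE,
      (forall e f, eqE e f -> eqV (org e) (org f) /\ eqV (trm e) (trm f)) &
      exists pi : vert G -> vert G -> edge G -> edge G,
        (forall v w, eqV v w ->
           set_bij [set e | org e = v]%classic [set e | org e = w]%classic
                   (pi v w)) /\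
        (forall e f, eqE e f <->
           eqV (org e) (org f) /\ pi (org e) (org f) e = f)].

Definition non_redundant (G : graph) : Prop :=
  forall (eqV : rel (vert G)) (eqE : rel (edge G)),
    nec_relation eqV eqE ->
    (forall v w, eqV v w <-> v = w) /\ (forall e f, eqE e f <-> e = f).

Record rooted_tree := RootedTree {
  tree :> graph;
  root : vert tree;
  root_path : forall v : vert tree, exists! p, is_path_to root v p }.

Section Reroot.
Variables (T : rooted_tree) (v : vert T).

Definition on_root_path (e : edge T) : bool :=
  `[< exists2 p, is_path_to (root T) v p & e \in p >].

Definition reroot : graph :=
  Graph (fun e : edge T => if on_root_path e then trm e else org e)
        (fun e : edge T => if on_root_path e then org e else trm e).
End Reroot.

Definition cocompact (T : rooted_tree) : Prop :=
  exists (F : finType) (l : vert T -> F),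
    forall v w : vert T, l v = l w -> graph_iso (reroot v) (reroot w).

Lemma terminus_rcons (G : graph) (v : vert G) p e :
  terminus v (rcons p e) = trm e.
Proof. by rewrite /terminus map_rcons last_rcons. Qed.

Lemma is_path_rcons (G : graph) (v : vert G) p e :
  is_path v (rcons p e) = is_path v p && (org e == terminus v p).
Proof.
by elim: p v => [|f p IHp] v /=; rewrite /terminus /= ?andbT // IHp andbA.
Qed.

Section Unfolding.
Variables (G : graph) (R : vert G).

Let V := {p : seq (edge G) | is_path R p}.

(* The tree edge [(p, pe)] is represented by the pair of [p] and [e]. *)
Let E := {pe : seq (edge G) * edge G |
            is_path R pe.1 && (org pe.2 == terminus R pe.1)}.

Fact unfolding_trm_subproof (x : E) :
  is_path R (rcons (val x).1 (val x).2).
Proof. by rewrite is_path_rcons (valP x). Qed.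

Let unf_org (x : E) : V := exist _ (val x).1 (proj1 (andP (valP x))).
Let unf_trm (x : E) : V :=
  exist (fun p => is_path R p) (rcons (val x).1 (val x).2)
    (unfolding_trm_subproof x).

Definition unfolding_graph : graph := Graph unf_org unf_trm.

Definition unfolding_root : vert unfolding_graph :=
  exist (fun p => is_path R p) [::] isT.

Fact unfolding_root_path (v : vert unfolding_graph) :
  exists! p, is_path_to unfolding_root v p.
Proof.
case: v => p; elim/last_ind: p => [|p e IHp] Pp.
  have -> : exist _ [::] Pp = unfolding_root by apply: val_inj.
  exists [::]; split=> // q [_]; case/lastP: q => // q x.
  rewrite terminus_rcons => /(congr1 val) /=.
  by case: (val x).1.
have Ppe := Pp; rewrite is_path_rcons in Ppe.
have Pp1 : is_path R p by case/andP: Ppe.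
pose x : edge unfolding_graph := exist _ (p, e) Ppe.
case: (IHp Pp1) => q [[qP qT] qU].
exists (rcons q x); split.
  split; last by rewrite terminus_rcons; apply: val_inj.
  by rewrite is_path_rcons qP qT; apply/eqP/val_inj.
move=> r [rP rT]; case/lastP: r rP rT => [|r y] rP rT.
  by move/(congr1 val): rT => /=; case: (p).
rewrite terminus_rcons in rT; move/(congr1 val): rT => /= /rcons_inj [Ep Ee].
have Exy : y = x by apply: val_inj => /=; rewrite -Ep -Ee; case: (val y).
move: rP; rewrite is_path_rcons Exy => /andP[rP /eqP rT].
by rewrite (qU r) //; split=> //; rewrite -rT; apply: val_inj.
Qed.

Definition unfolding_tree : rooted_tree := RootedTree unfolding_root_path.
End Unfolding.

Record fin_graph := FinGraph {
  fvert : finType;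
  fedge : finType;
  forg : fedge -> fvert;
  ftrm : fedge -> fvert }.

Coercion graph_of_fin_graph (G : fin_graph) : graph :=
  Graph (@forg G) (@ftrm G).

Definition mset_map (A B : choiceType) (f : A -> B) (M : {mset A}) : {mset B} :=
  seq_mset [seq f a | a <- enum_mset M].

Definition out_termini (G : fin_graph) (v : fvert G) : {mset fvert G} :=
  seq_mset [seq ftrm e | e <- enum (fedge G) & forg e == v].

Definition is_actual_labelling (G : fin_graph) (R : fvert G) (X : finType)
    (l : fvert G -> X) (lp : {v : fvert G | v != R} -> X) (M : X -> {mset X})
    : Prop :=
  (forall v : {v : fvert G | v != R},
     [/\ lp v \in M (l (val v)),
         mset_map l (out_termini (val v)) = M (l (val v)) `\ lp v &
         forall e : fedge G, ftrm e = val v -> l (forg e) = lp v]) /\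
  mset_map l (out_termini R) = M (l R).

Definition has_actual_labelling (G : fin_graph) (R : vert G) : Prop :=
  exists (X : finType) (l : fvert G -> X) (lp : {v : fvert G | v != R} -> X)
         (M : X -> {mset X}), is_actual_labelling l lp M.

(* Main.v *)
Require Import Defs.
From mathcomp Require Import all_boot.
From mathcomp Require Import finmap multiset.
From mathcomp Require Import boolp.
From mathcomp Require Import zify.

(** Every edge of the unfolding tree T cuts it into a cone T(G,v) and a back
    branch containing the root. The back branch at the end of p e consists of
    the back branch at the end of p together with the cones of the siblings of
    e; hence, the cones being locally finite, the back branches at p e and at
    q e are isomorphic iff those at p and at q are. Cocompactness leaves only
    finitely many isomorphism classes of back branches, so for a closed path g
    at the end of p some power g^m with m > 0 satisfies B(p) = B(p g^m) = B(p
    g^(2m)) = ..., and deep powers of g determine the back branch up to any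
    given depth. Thus B(p) depends only on the terminus of p, and labelling v
    by the class of T rerooted at any vertex with terminus v is an actual
    labelling. All isomorphism classes are replaced by their truncations to
    finite depth, and one depth suffices since VG is finite. *)

Set Implicit Arguments.
Unset Strict Implicit.
Unset Printing Implicit Defensive.

(* Canonical code of the multiset listed by s: depth-n types of trees are coded
   as natural numbers. *)
Definition code (s : seq nat) : nat := choice.pickle (sort leq s).
Definition decode (k : nat) : seq nat := odflt [::] (choice.unpickle k).

Lemma codeK s : perm_eq (decode (code s)) s.
Proof. by rewrite /decode choice.pickleK perm_sort. Qed.

Lemma code_perm s s' : perm_eq s s' -> code s = code s'.
Proof.
by move=> ss'; congr choice.pickle; apply/perm_sortP => //;
  [exact: leq_total | exact: leq_trans | exact: anti_leq].
Qed.

Lemma code_inj s s' : code s = code s' -> perm_eq s s'.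
Proof. by move=> ss'; rewrite -(permPl (codeK s)) ss' codeK. Qed.

(** Truncation acts on the codes themselves, so equality of deep types descends to shallower depths
    without looking at the trees. *)
Fixpoint trunc n k : nat :=
  if n is n'.+1 then code [seq trunc n' i | i <- decode k] else 0.

Lemma trunc_code n s : trunc n.+1 (code s) = code [seq trunc n i | i <- s].
Proof. exact/code_perm/perm_map/codeK. Qed.

Section GraphPaths.
Variable G : graph.
Implicit Types (v : vert G) (p q : seq (edge G)).

Lemma is_path_cat v p q :
  is_path v (p ++ q) = is_path v p && is_path (terminus v p) q.
Proof. by elim: p v => //= e p IHp v; rewrite IHp andbA. Qed.

Lemma terminus_cat v p q : terminus v (p ++ q) = terminus (terminus v p) q.
Proof. by rewrite /terminus map_cat last_cat. Qed.

End GraphPaths.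

(** * Types of cones and back branches *)

Section Types.
Variable G : fin_graph.
Implicit Types (u v w : fvert G) (e f : fedge G) (r g : seq (fedge G)).

Definition outs v := [seq e <- enum (fedge G) | forg e == v].

Lemma outs_uniq v : uniq (outs v).
Proof. by rewrite filter_uniq // enum_uniq. Qed.

Lemma mem_outs v e : (e \in outs v) = (forg e == v).
Proof. by rewrite mem_filter mem_enum andbT. Qed.

Fixpoint cone n v : nat :=
  if n is n'.+1 then code [seq cone n' (ftrm e) | e <- outs v] else 0.

Definition kids n v := [seq cone n (ftrm e) | e <- outs v].
Definition sibs n e := [seq cone n (ftrm f) | f <- rem e (outs (forg e))].

(* The branch of the tree seen from the end of a path towards the root, cut at
   depth n; the path is listed from its last edge to its first, and the root
   has no such branch. *)
Fixpoint back n r {struct r} : seq nat :=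
  if r is e :: r' then
    [:: if n is n'.+1 then code (back n' r' ++ sibs n' e) else 0]
  else [::].

Lemma trunc_cone n v : trunc n (cone n.+1 v) = cone n v.
Proof.
elim: n v => // n IHn v; rewrite [cone n.+2 v]/= trunc_code -map_comp.
by congr code; apply: eq_map => e; exact: IHn.
Qed.

Lemma trunc_kids n v : map (trunc n) (kids n.+1 v) = kids n v.
Proof. by rewrite -map_comp; apply: eq_map => e; exact: trunc_cone. Qed.

Lemma trunc_sibs n e : map (trunc n) (sibs n.+1 e) = sibs n e.
Proof. by rewrite -map_comp; apply: eq_map => f; exact: trunc_cone. Qed.

Lemma trunc_back n r : map (trunc n) (back n.+1 r) = back n r.
Proof.
elim: r n => [|e r IHr] [|n] //=.
congr [:: _]; rewrite -[LHS]/(trunc n.+1 (code _)) trunc_code map_cat IHr.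
by rewrite trunc_sibs.
Qed.

Lemma kids_sibs n e : perm_eq (kids n (forg e)) (cone n (ftrm e) :: sibs n e).
Proof.
rewrite -/(map (fun f => cone n (ftrm f)) (e :: rem e _)) perm_map //.
by rewrite perm_to_rem // mem_outs.
Qed.

Lemma back_eqW m n r r' :
  m <= n -> back n r = back n r' -> back m r = back m r'.
Proof.
elim: n m => [|n IHn] m; first by rewrite leqn0 => /eqP->.
rewrite leq_eqVlt => /predU1P[-> //|]; rewrite ltnS => /IHn le_mn eq_n.
by apply: le_mn; rewrite -!(trunc_back n) eq_n.
Qed.

(** The siblings of [e] cancel as a common submultiset, and what remains has at most one entry,
    where permutation is equality. *)
Lemma back_consS n e r r' :
  back n.+1 (e :: r) = back n.+1 (e :: r') <-> back n r = back n r'.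
Proof.
split=> [[/code_inj]|/= -> //]; rewrite perm_cat2r.
by apply: perm_small_eq; case: r'.
Qed.

Lemma back_cat n g r r' :
  back n r = back n r' -> back n (g ++ r) = back n (g ++ r').
Proof.
move=> rr'; elim: g => // e g IHg.
by apply: (@back_eqW _ n.+1) => //; apply/back_consS.
Qed.

(** Each cancelled edge costs one level of depth, whence the surplus [size g]. *)
Lemma back_cat_inj n g r r' :
  back (n + size g) (g ++ r) = back (n + size g) (g ++ r') ->
  back n r = back n r'.
Proof.
by elim: g => [|e g IHg] /=; rewrite ?addn0 // addnS => /back_consS.
Qed.

(** The recursion reaches depth 0 inside [g]. The inequality is strict because even at depth 0
    [back] tells the empty path from the others. *)
Lemma back_depth n g r r' :
  n < size g -> back n (g ++ r) = back n (g ++ r').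
Proof. by elim: n g => [|n IHn] [|e g] //= /IHn ->. Qed.

End Types.

(** * Edges and roots of the rerooted unfolding trees *)

Lemma prefix_rconsr (A : eqType) (s t : seq A) x :
  prefix s (rcons t x) = (s == rcons t x) || prefix s t.
Proof.
apply/prefixP/orP => [[s']|[/eqP->|/prefixP[s' ->]]]; last first.
- by exists (rcons s' x); rewrite -rcons_cat.
- by exists [::]; rewrite cats0.
case/lastP: s' => [->|s' y]; first by left; rewrite cats0.
by rewrite -rcons_cat => /rcons_inj[-> _]; right; apply: prefix_prefix.
Qed.

Section UnfoldingTree.
Variables (G : graph) (R : vert G).
Notation T := (unfolding_tree R).
Implicit Types (P Q : vert T) (x : edge T) (p q : seq (edge G)).

Definition tree_vert p (Pp : is_path R p) : vert T := exist _ p Pp.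

Lemma tree_vert_inj P Q : sval P = sval Q -> P = Q.
Proof. exact: val_inj. Qed.

Lemma tree_edge_inj (x y : edge T) : sval x = sval y -> x = y.
Proof. exact: val_inj. Qed.

Lemma tree_trm x : sval (trm x) = rcons (sval x).1 (sval x).2.
Proof. by []. Qed.

Lemma tree_path_prefix P Q s : is_path_to P Q s -> prefix (sval P) (sval Q).
Proof.
elim/last_ind: s Q => [|s x IHs] Q [].
  by move=> _ <-; apply: prefix_refl.
rewrite is_path_rcons terminus_rcons => /andP[sP /eqP sx] <-.
apply: prefix_trans (IHs _ (conj sP (esym sx))) _.
by rewrite tree_trm; apply: prefix_rcons.
Qed.

Lemma prefix_tree_path P Q :
  prefix (sval P) (sval Q) -> exists s, is_path_to P Q s.
Proof.
case: Q => q; elim/last_ind: q => [|q e IHq] Qq Pq.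
  have {}Pq : prefix (sval P) [::] := Pq; rewrite prefixs0 in Pq.
  by exists [::]; split=> //; apply/tree_vert_inj/eqP.
have {}Pq : prefix (sval P) (rcons q e) := Pq.
move: Pq; rewrite prefix_rconsr => /predU1P[Pqe|Pq].
  by exists [::]; split=> //; apply: tree_vert_inj.
have Qqe := Qq; rewrite is_path_rcons in Qqe.
have [qR _] := andP Qqe; have [s [sP sq]] := IHq qR Pq.
pose x : edge T := exist _ (q, e) Qqe.
exists (rcons s x); split.
  by rewrite is_path_rcons sP sq; apply/eqP/tree_vert_inj.
by rewrite terminus_rcons; apply: tree_vert_inj.
Qed.

Lemma on_root_pathE P x :
  on_root_path P x = prefix (rcons (sval x).1 (sval x).2) (sval P).
Proof.
apply/asboolP/idP => [[s [sR sP]] xs|/(@prefix_tree_path (trm x)) [s [sx sP]]].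
  case/splitPr: xs sR sP => s1 s2; rewrite is_path_cat terminus_cat /=.
  move=> /and3P[_ _ s2P] s2T; rewrite -tree_trm.
  by apply: (@tree_path_prefix _ _ s2); split.
have [s' [s'R s'x]] :=
  @prefix_tree_path (unfolding_root R) (org x) (prefix0s _).
exists (s' ++ x :: s); last by rewrite mem_cat mem_head orbT.
split; first by rewrite is_path_cat s'R s'x /= eqxx.
by rewrite terminus_cat.
Qed.

(** Makes isomorphisms of rerooted trees respect the new roots. A proper prefix of [P] is entered by
    a reversed edge, a vertex off the path by its own last edge. *)
Lemma reroot_no_in_edge P Q :
  (forall x : edge (reroot P), trm x <> Q) <-> Q = P.
Proof.
split=> [noin|-> x]; last first.
  rewrite /= on_root_pathE; case: ifP => xP.
    move=> /(congr1 sval) /=; rewrite -[X in X = _]/(sval x).1 => xE.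
    have := size_prefix xP.
    by rewrite -xE size_rcons ltnn.
  move/(congr1 sval) => /=; rewrite -/(rcons _ _) => xE.
  by rewrite -xE prefix_refl in xP.
have [QP|/negP nQP] := boolP (prefix (sval Q) (sval P)).
  have [s QPs] := prefixP QP; case: s QPs => [|e s] QPs.
    by apply: tree_vert_inj; rewrite QPs cats0.
  have Qe : is_path R (sval Q) && (org e == terminus R (sval Q)).
    have := svalP P; rewrite QPs -cat_rcons is_path_cat -is_path_rcons.
    by case/andP.
  case: (noin (exist _ (sval Q, e) Qe)) => /=.
  rewrite on_root_pathE /= QPs -cat_rcons prefix_prefix.
  exact: tree_vert_inj.
case: Q noin nQP => q; case/lastP: q => [|q e] Qq noin /= nQP.
  by case: nQP; apply: prefix0s.
have Qqe := Qq; rewrite is_path_rcons in Qqe.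
case: (noin (exist _ (q, e) Qqe)) => /=.
rewrite on_root_pathE /=; case: ifP => // _.
exact: tree_vert_inj.
Qed.

End UnfoldingTree.

(** * Isomorphism invariance of depth-n types *)

Definition is_typing (H : graph) (tau : nat -> vert H -> nat) : Prop :=
  forall x, tau 0 x = 0 /\ exists s : seq (edge H),
    [/\ uniq s, forall e, (e \in s) = (org e == x) &
        forall n, tau n.+1 x = code [seq tau n (trm e) | e <- s]].

(** Induction on the depth: [h] carries a list of the edges leaving [x] to a list of those leaving
    [f x]. *)
Lemma typing_iso (H K : graph) (f : vert H -> vert K) (h : edge H -> edge K)
    tau sigma :
  bijective f -> bijective h ->
  (forall e, org (h e) = f (org e) /\ trm (h e) = f (trm e)) ->
  is_typing tau -> is_typing sigma -> forall n x, sigma n (f x) = tau n x.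
Proof.
move=> f_bij h_bij fh tauP sigmaP; elim=> [|n IHn] x.
  by rewrite (tauP x).1 (sigmaP (f x)).1.
have [_ [s [s_uniq s_mem ->]]] := tauP x.
have [_ [s' [s'_uniq s'_mem ->]]] := sigmaP (f x).
have -> : [seq tau n (trm e) | e <- s] = [seq sigma n (trm e) | e <- map h s].
  by rewrite -map_comp; apply: eq_map => e /=; rewrite (fh e).2 IHn.
apply/code_perm/perm_map/uniq_perm => //.
  by rewrite map_inj_uniq //; apply: bij_inj.
move=> e; rewrite s'_mem; have [k kK hK] := h_bij.
rewrite -(hK e) mem_map; last exact: bij_inj.
by rewrite s_mem (fh _).1 (inj_eq (bij_inj f_bij)).
Qed.

(** * Types in the rerooted unfolding tree *)

Section RerootTyping.
Variables (G : fin_graph) (R : vert G).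
Notation T := (unfolding_tree R).
Notation ends p := (terminus (G := G) R p).
Implicit Types (P Q : vert T) (x : edge T) (p q : seq (edge G)).

(* The type of the unfolding tree rerooted at p. *)
Definition center n p : nat :=
  code (back n (rev p) ++ kids n (ends p)).

(* The depth-n type of the vertex q of the unfolding tree rerooted at p. *)
Definition reroot_type p n q : nat :=
  if prefix q p then
    if q == p then if n is n'.+1 then center n' p else 0
    else head 0 (back n (rev (take (size q).+1 p)))
  else cone n (ends q).

Lemma reroot_type_out p n q :
  ~~ prefix q p -> reroot_type p n q = cone n (ends q).
Proof. by rewrite /reroot_type => /negPf->. Qed.

(** After rerooting, [q] is entered from [rcons q e], its successor towards [p], so what hangs at
    [q] is the branch seen back from there. *)
Lemma reroot_type_on p n q e :
  prefix (rcons q e) p -> back n (rev (rcons q e)) = [:: reroot_type p n q].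
Proof.
move=> /prefixP[s ->]; rewrite /reroot_type cat_rcons prefix_prefix ifF.
  by rewrite -cat_rcons -(size_rcons q e) take_size_cat // rev_rcons.
by apply/negP => /eqP/(congr1 size); rewrite size_cat /=; lia.
Qed.

Lemma reroot_typeP P :
  is_typing (fun n (Q : vert (reroot P)) => reroot_type (sval P) n (sval Q)).
Proof.
set p := sval P => Q; set q := sval Q; have Qq : is_path R q := svalP Q; split.
  rewrite /reroot_type; case: ifP => // qp; case: ifP => // _.
  by case: (rev _).
(* The edges leaving [q] after rerooting are the reversed edge to its parent, if [q] lies on the
   path to [p], and the edges to children off that path. They are listed as raw pairs and lifted to
   tree edges later. *)
pose up :=
  if prefix q p then if rev q is e :: q' then [:: (rev q', e)] else [::]
  else [::].
pose ps := up ++ [seq (q, e) | e <- outs (ends q) & ~~ prefix (rcons q e) p].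
pose ok (y : seq (edge G) * edge G) := is_path R y.1 && (org y.2 == ends y.1).
have up_mem q0 e0 : ((q0, e0) \in up) = prefix q p && (rcons q0 e0 == q).
  rewrite /up; case: ifP => //= _; case: (lastP q) => [|q1 e1].
    by rewrite /= in_nil; case: q0.
  by rewrite rev_rcons /= inE revK eqseq_rcons xpair_eqE.
have down_mem q0 e0 (a : pred (edge G)) :
    ((q0, e0) \in [seq (q, e) | e <- outs (ends q) & a e]) =
    [&& q0 == q, org e0 == ends q & a e0].
  apply/mapP/and3P => [[e + [-> ->]]|[/eqP-> e0q ae0]].
    by rewrite mem_filter mem_outs => /andP[].
  by exists e0; rewrite // mem_filter mem_outs ae0.
have psP q0 e0 : ((q0, e0) \in ps) = ok (q0, e0) &&
    (if prefix (rcons q0 e0) p then rcons q0 e0 == q else q0 == q).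
  rewrite mem_cat up_mem down_mem /ok /= -is_path_rcons.
  have [{q0}->|q0q] := eqVneq q0 q; rewrite ?orbF /=.
    have -> : (rcons q e0 == q) = false.
      by apply/eqP => /(congr1 size); rewrite size_rcons; lia.
    by rewrite andbF is_path_rcons Qq; case: ifP; rewrite /= ?andbF ?andbT.
  have [->|_] := eqVneq (rcons q0 e0) q; last by case: ifP; rewrite !andbF.
  by rewrite Qq andbT; case: ifP.
have ps_uniq : uniq ps.
  rewrite cat_uniq; apply/and3P; split.
  - by rewrite /up; case: ifP => // _; case: (rev q).
  - apply/hasPn => -[q0 e0]; rewrite down_mem up_mem => /and3P[/eqP-> _ _].
    by apply/negP => /andP[_ /eqP/(congr1 size)]; rewrite size_rcons; lia.
  - rewrite map_inj_uniq => [|? ? []] //; exact/filter_uniq/outs_uniq.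
have ps_ok : all ok ps by apply/allP => -[q0 e0]; rewrite psP => /andP[].
pose s : seq (edge T) := pmap insub ps.
have s_val : map sval s = ps.
  rewrite /s pmap_filter; last exact: insubK.
  by apply/all_filterP; apply: sub_all ps_ok => y yok; rewrite insubT.
exists s; split.
- by rewrite -(map_inj_uniq (@tree_edge_inj _ R)) s_val.
- move=> x; rewrite -(mem_map (@tree_edge_inj _ R)) s_val.
  have -> : (org x == Q) = (sval (org x) == q).
    by apply/eqP/eqP => [-> //|/tree_vert_inj].
  have [xok xP] : ok (sval x) /\ sval (org x) =
      if prefix (rcons (sval x).1 (sval x).2) p then rcons (sval x).1 (sval x).2
      else (sval x).1.
    split; first exact: svalP x.
    by rewrite [org x]/= on_root_pathE; case: ifP.
  by rewrite xP; case: (sval x) xok => q0 e0 xok; rewrite psP xok /=; case: ifP.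
move=> n.
have -> : [seq reroot_type p n (sval (trm e)) | e : edge (reroot P) <- s] =
    [seq reroot_type p n (if prefix (rcons y.1 y.2) p then y.1
                          else rcons y.1 y.2) | y <- ps].
  rewrite -s_val -map_comp; apply: eq_map => x /=.
  by rewrite on_root_pathE; case: ifP.
rewrite /ps map_cat -map_comp.
have [qp|nqp] := boolP (prefix q p); last first.
  have np e : ~~ prefix (rcons q e) p.
    by apply: contra nqp; apply: prefix_trans; apply: prefix_rcons.
  rewrite reroot_type_out // /up (negPf nqp) /=; congr code.
  rewrite (eq_filter (a2 := predT)) ?filter_predT; last by move=> e; rewrite np.
  apply: eq_map => e /=; rewrite (negPf (np e)) reroot_type_out //.
  by rewrite terminus_rcons.
have -> : [seq reroot_type p n (if prefix (rcons y.1 y.2) p then y.1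
              else rcons y.1 y.2) | y <- up] = back n (rev q).
  rewrite /up qp; case: (lastP q) qp => //= q1 e1 q1p.
  by rewrite (reroot_type_on n q1p) rev_rcons /= revK q1p.
have -> : [seq ((fun y => reroot_type p n (if prefix (rcons y.1 y.2) p then y.1
                  else rcons y.1 y.2)) \o pair q) e
            | e <- outs (ends q) & ~~ prefix (rcons q e) p] =
          [seq cone n (ftrm e) | e <- outs (ends q) & ~~ prefix (rcons q e) p].
  apply/eq_in_map => e /=; rewrite mem_filter => /andP[np _].
  by rewrite (negPf np) reroot_type_out // terminus_rcons.
(* At [q = p] all children remain; strictly above [p] the child towards [p] drops out, leaving the
   siblings of [e]. *)
have [s0 pE] := prefixP qp; case: s0 pE => [|e s0] pE.
  rewrite cats0 in pE; rewrite -pE /reroot_type prefix_refl eqxx /center.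
  rewrite (eq_filter (a2 := predT)) ?filter_predT // => e.
  by apply/negP => /size_prefix; rewrite size_rcons; lia.
have qep : prefix (rcons q e) p by rewrite pE -cat_rcons prefix_prefix.
have := reroot_type_on n.+1 qep; rewrite rev_rcons => -[<-].
congr (code (_ ++ _)).
have -> : sibs n e = [seq cone n (ftrm f) | f <- rem e (outs (ends q))].
  congr (map _ (rem _ (outs _))).
  have := svalP P; rewrite -/p pE -cat_rcons is_path_cat is_path_rcons.
  by case/andP => /andP[_ /eqP].
rewrite rem_filter ?outs_uniq //; congr (map _ _); apply: eq_filter => f /=.
by rewrite pE -cats1 prefix_catr // eqxx /= prefix0s andbT.
Qed.

Lemma center_iso P Q n :
  graph_iso (reroot P) (reroot Q) -> center n (sval P) = center n (sval Q).
Proof.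
move=> [f [h [f_bij h_bij fh]]].
have fPQ : f P = Q.
  apply/reroot_no_in_edge => x; have [k hK kK] := h_bij.
  rewrite -(kK x) (fh _).2 => /(bij_inj f_bij).
  exact: (reroot_no_in_edge P P).2 erefl _.
(* At the root, [reroot_type] at depth [n.+1] is [center n]. *)
have := typing_iso f_bij h_bij fh (@reroot_typeP P) (@reroot_typeP Q) n.+1 P.
by rewrite fPQ /reroot_type !prefix_refl !eqxx.
Qed.

End RerootTyping.

(** * Uniqueness of back branches under cocompactness *)

Section Cocompact.
Variables (G : fin_graph) (R : vert G).
Notation ends p := (terminus (G := G) R p).
Implicit Types (u v w : vert G) (e : edge G) (p q r g : seq (edge G)).

Lemma size_outs (v : fvert G) : size (outs v) <= #|fedge G|.
Proof. by rewrite size_filter cardE count_size. Qed.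

(** Vertices of equal colour have the same decoded list of branches, so the position of the back
    branch in that list determines it. *)
Lemma back_pigeonhole :
  cocompact (unfolding_tree R) ->
  exists K, forall n (r : nat -> seq (edge G)),
    (forall i, r i != [::] /\ is_path R (rev (r i))) ->
    exists i j, [/\ i < j, j <= K & back n (r i) = back n (r j)].
Proof.
(* The bound counts pairs of a colour and a position among at most [#|fedge G|.+1] branches, and so
   is independent of [n]. *)
move=> [F [l lP]]; exists #|{: F * 'I_(#|fedge G|).+1}| => n r rP.
set K := #|_|.
pose P i : vert (unfolding_tree R) := tree_vert (rP i).2.
pose c i := decode (center R n (rev (r i))).
have cP i : perm_eq (c i) (back n (r i) ++ kids n (ends (rev (r i)))).
  by rewrite /c /center revK codeK.
have cE i j : l (P i) = l (P j) -> c i = c j.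
  by move=> /lP/(@center_iso _ _ _ _ n) /= cij; rewrite /c cij.
pose b i := head 0 (back n (r i)).
have bE i : back n (r i) = [:: b i].
  by rewrite /b; case: (r i) (rP i).1.
have b_mem i : b i \in c i by rewrite (perm_mem (cP i)) bE mem_head.
have idx_lt i : index (b i) (c i) < #|fedge G|.+1.
  apply: leq_trans (_ : size (c i) <= _); first by rewrite index_mem.
  by rewrite (perm_size (cP i)) bE /= ltnS size_map size_outs.
pose h (i : 'I_K.+1) := (l (P i), Ordinal (idx_lt i)).
have /injectivePn[i [j ij hij]] : ~~ injectiveb h.
  apply/injectiveP => /leq_card; rewrite card_ord.
  by rewrite ltnn.
wlog lt_ij : i j ij hij / i < j.
  move=> W; have [|ji|/val_inj ij0] := ltngtP i j; first exact: W.
    by apply: (W j i); rewrite // eq_sym.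
  by rewrite ij0 eqxx in ij.
exists i, j; split; [exact: lt_ij | rewrite -ltnS; exact: ltn_ord |].
rewrite !bE.
have [/cE cij idx] : l (P i) = l (P j) /\ index (b i) (c i) = index (b j) (c j).
  by case: hij => -> ->.
by rewrite -(nth_index 0 (b_mem i)) -(nth_index 0 (b_mem j)) idx cij.
Qed.

Lemma iter_cat g r m : iter m (cat g) r = flatten (nseq m g) ++ r.
Proof. by elim: m => //= m ->; rewrite catA. Qed.

Lemma size_flatten_nseq m g : size (flatten (nseq m g)) = m * size g.
Proof. by elim: m => //= m; rewrite size_cat => ->; rewrite mulSn. Qed.

Lemma back_iter_inj n m g r r' :
  back (n + m * size g) (iter m (cat g) r) =
  back (n + m * size g) (iter m (cat g) r') ->
  back n r = back n r'.
Proof.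
by rewrite -size_flatten_nseq !iter_cat; apply: back_cat_inj.
Qed.

Hypothesis T_cocompact : cocompact (unfolding_tree R).

Lemma back_period w g p n :
  is_path_to w w g -> is_path_to R w p -> p != [::] ->
  exists2 m, 0 < m & back n (rev p) = back n (iter m (cat (rev g)) (rev p)).
Proof.
move=> [gP gw] [pP pw] p0; have [K KP] := back_pigeonhole T_cocompact.
pose r i := iter i (cat (rev g)) (rev p).
have rP i : [/\ r i != [::], is_path R (rev (r i)) & ends (rev (r i)) = w].
  elim: i => [|i [ri0 riP riw]].
    by rewrite /r /= revK -size_eq0 size_rev size_eq0.
  rewrite /r iterS -/(r i) rev_cat revK is_path_cat terminus_cat riP riw gP gw.
  by split=> //; case: (r i) ri0 => // ? ? _; case: (rev g).
(* The surplus depth [K * size g] pays for cancelling the first [i <= K] copies of [g]. *)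
have [|i [j [ij jK rij]]] := KP (n + K * size g) r.
  by move=> i; have [] := rP i.
exists (j - i); first by rewrite subn_gt0.
apply: (@back_iter_inj _ i (rev g)).
rewrite -iterD subnKC; last exact: ltnW.
apply: back_eqW rij; rewrite size_rev leq_add2l leq_mul2r.
by rewrite (leq_trans (ltnW ij) jK) orbT.
Qed.

Lemma back_period_iter n m k g r :
  back n r = back n (iter m (cat g) r) ->
  back n r = back n (iter (m * k) (cat g) r).
Proof.
move=> rE; elim: k => [|k IHk]; first by rewrite muln0.
rewrite mulnS iterD rE !iter_cat; apply: back_cat.
by rewrite -iter_cat.
Qed.

Lemma back_unique w g p q n :
  is_path_to w w g -> g != [::] ->
  is_path_to R w p -> is_path_to R w q -> p != [::] -> q != [::] ->
  back n (rev p) = back n (rev q).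
Proof.
move=> gw g0 pw qw p0 q0.
have [m m0 pE] := back_period n gw pw p0.
have [m' m'0 qE] := back_period n gw qw q0.
(* Both paths are extended by the same power of [g], a common multiple of the periods; the factor
   [n.+1] makes it longer than [n]. *)
rewrite (back_period_iter (m' * n.+1) pE) (back_period_iter (m * n.+1) qE).
rewrite mulnCA !iter_cat; apply: back_depth.
have g_gt0 : 0 < size g by case: (g) g0.
rewrite size_flatten_nseq size_rev; apply: leq_trans (leq_pmulr _ g_gt0).
by rewrite mulnA leq_pmull // muln_gt0 m0 m'0.
Qed.

End Cocompact.

(** * Nonempty closed paths away from the root *)

Section Loops.
Variables (G : fin_graph) (R : vert G).

Lemma del_vertex_path (v w : vert (del_vertex R)) s :
  is_path_to v w s -> is_path_to (G := G) (sval v) (sval w) (map sval s).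
Proof.
elim: s v => [|e s IHs] v [].
  by move=> _ <-.
move=> /= /andP[/eqP ev sP] sw; have [] := IHs (trm e) (conj sP sw).
move=> sP' sw'; split=> //=.
by rewrite -ev /= eqxx.
Qed.

Lemma loop_at (v : vert G) :
  (forall v : vert G, ~ sink v) -> (forall e : edge G, trm e <> R) ->
  strongly_connected (del_vertex R) -> v != R ->
  exists2 g : seq (edge G), is_path_to v v g & g != [::].
Proof.
move=> no_sink no_in conn vR.
have [e ev] : exists e : edge G, org e = v.
  by have /existsNP[e] := @no_sink v; move/contrapT => ev; exists e.
have eR : trm e != R by apply/eqP/no_in.
have [s /del_vertex_path[sP sv]] := conn (exist _ (trm e) eR) (exist _ v vR).
exists (e :: map sval s) => //; split=> //=.
by apply/andP; split=> //; apply/eqP.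
Qed.
End Loops.

Lemma decreasing_sets_stabilise (T : finType) (E : nat -> {set T}) :
  (forall n, E n.+1 \subset E n) -> exists n, E n.+1 = E n.
Proof.
move=> E_sub; apply: contrapT => /forallNP neqE.
have E_card n : #|E n| + n <= #|E 0|.
  elim: n => [|n IHn]; first by rewrite addn0.
  apply: leq_trans IHn; rewrite addnS -addSn leq_add2r proper_card //.
  by rewrite finset.properEneq E_sub andbT; apply/eqP.
by have := E_card #|E 0|.+1; lia.
Qed.

(** * The labelling by stable vertex types *)

Section Labelling.
Variables (G : fin_graph) (R : fvert G) (up : nat -> fvert G -> seq nat).
Hypothesis up_root : forall n, up n R = [::].
Hypothesis up_edge : forall n (e : fedge G),
  up n.+1 (ftrm e) = [:: code (up n (forg e) ++ sibs n e)].
Hypothesis up_trunc : forall n v, map (trunc n) (up n.+1 v) = up n v.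
Hypothesis R_no_in : forall e : fedge G, ftrm e != R.
Hypothesis has_in : forall v, v != R -> exists e : fedge G, ftrm e = v.

Definition vertex_type n v := code (up n v ++ kids n v).

Lemma trunc_vertex_type n v : trunc n.+1 (vertex_type n.+1 v) = vertex_type n v.
Proof. by rewrite trunc_code map_cat up_trunc trunc_kids. Qed.

(** Seen from the origin of [e], the tree consists of the cone beyond [e] and the branches making up
    the back branch at its terminus. The type of the origin thus depends on the terminus alone. *)
Lemma vertex_type_org n e :
  vertex_type n (forg e) =
  code (cone n (ftrm e) :: decode (head 0 (up n.+1 (ftrm e)))).
Proof.
rewrite up_edge /=; have -> s x : code (x :: decode (code s)) = code (x :: s).
  by apply: code_perm; rewrite perm_cons codeK.
apply: code_perm; rewrite perm_sym -cat1s perm_catCA perm_cat2l cat1s perm_sym.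
exact: kids_sibs.
Qed.

(** Deeper types induce finer equivalence relations on the finite set of vertices. *)
Lemma vertex_type_stabilises :
  exists k, forall v w,
    vertex_type k.+1 v = vertex_type k.+1 w ->
    vertex_type k.+2 v = vertex_type k.+2 w.
Proof.
pose E n :=
  [set x : fvert G * fvert G | vertex_type n.+1 x.1 == vertex_type n.+1 x.2].
have [|k Ek] := @decreasing_sets_stabilise _ E.
  move=> n; apply/fintype.subsetP => x; rewrite !inE => /eqP xE.
  by rewrite -!(trunc_vertex_type n.+1) xE.
exists k => v w /eqP vw; apply/eqP.
by have : (v, w) \in E k.+1; [rewrite Ek inE | rewrite inE].
Qed.

(** One incoming edge is chosen, as a tree vertex has one parent; by [vertex_type_org] the parent's
    type does not depend on the choice. *)
Definition parents v : seq (fvert G) :=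
  if [pick e | ftrm e == v] is Some e then [:: forg e] else [::].

Definition nbrs v := parents v ++ [seq ftrm e | e <- outs v].

(* Recovers the type of a neighbour of v from the type x of its branch: seen
   from that neighbour, v carries all the branches at v but x. *)
Definition nbr_type k v x : nat :=
  let tr y := trunc k (trunc k.+1 y) in
  code (code (rem (tr x) (map tr (decode (vertex_type k.+2 v)))) :: decode x).

Lemma nbr_typeE k v x s :
  perm_eq (up k v ++ kids k v) (trunc k (trunc k.+1 x) :: s) ->
  nbr_type k v x = code (code s :: decode x).
Proof.
(* The double truncation brings [x] to depth [k]; then [code s] has depth [k.+1], like the entries
   of [decode x]. *)
move=> xs; rewrite /nbr_type; congr (code (_ :: _)); apply: code_perm.
rewrite -(perm_cons (trunc k (trunc k.+1 x))) perm_sym -(permPl xs).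
have tr_type : perm_eq
    (map (fun y => trunc k (trunc k.+1 y)) (decode (vertex_type k.+2 v)))
    (up k v ++ kids k v).
  rewrite (map_comp (trunc k) (trunc k.+1)).
  rewrite (permPl (perm_map _ (perm_map _ (codeK _)))).
  by rewrite !map_cat !up_trunc !trunc_kids.
rewrite -(permPl tr_type); apply: perm_to_rem.
by rewrite (perm_mem tr_type) (perm_mem xs) mem_head.
Qed.

(** Hence the type of [v] at level [k.+2] determines the types of its neighbours at level [k.+1]:
    the back branch yields the parent, each cone a child. *)
Lemma nbr_types k v :
  [seq nbr_type k v x | x <- up k.+2 v ++ kids k.+2 v] =
  [seq vertex_type k.+1 w | w <- nbrs v].
Proof.
rewrite !map_cat -!map_comp; congr (_ ++ _).
  rewrite /parents; case: pickP => [e /eqP<-|no_in]; last first.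
    suff -> : v = R by rewrite up_root.
    by apply/eqP/negPn/negP => /has_in[e ev]; have := no_in e; rewrite ev eqxx.
  rewrite [RHS]/= vertex_type_org.
  case x_def: (up k.+2 (ftrm e)) => [|x [|? ?]] /=;
    rewrite up_edge in x_def => //.
  congr [:: _]; rewrite (@nbr_typeE _ _ _ (kids k (ftrm e))) //.
  have -> : trunc k (trunc k.+1 x) = head 0 (up k (ftrm e)).
    by rewrite -up_trunc -up_trunc up_edge x_def.
  by rewrite -up_trunc up_edge.
apply/eq_in_map => e; rewrite mem_outs => /eqP <- {v}.
rewrite /comp (@nbr_typeE _ _ _ (up k (forg e) ++ sibs k e)).
  rewrite /vertex_type up_edge; apply: code_perm; rewrite perm_cons.
  exact: codeK.
rewrite !trunc_cone -cat1s perm_sym perm_catCA perm_cat2l cat1s perm_sym.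
exact: kids_sibs.
Qed.

Local Open Scope mset_scope.

Lemma labelling_of_types : has_actual_labelling R.
Proof.
have [k stable] := vertex_type_stabilises.
pose X : finType := seq_sub (codom (vertex_type k.+1)).
pose l v : X := SeqSub (codom_f (vertex_type k.+1) v).
(* The defaults [l R] here and [mset0] below never occur: [v] has an incoming edge, and every label
   in [X] is attained. *)
pose lp (v : {v : fvert G | v != R}) : X :=
  if [pick e | ftrm e == val v] is Some e then l (forg e) else l R.
pose M x : {mset X} :=
  if [pick v | l v == x] is Some v then seq_mset (map l (nbrs v)) else mset0.
have l_inj v w : vertex_type k.+1 v = vertex_type k.+1 w -> l v = l w.
  by move=> vw; apply: val_inj.
have ME v : M (l v) = seq_mset (map l (nbrs v)).
  rewrite /M; case: pickP => [w /eqP wv|/(_ v)]; last by rewrite eqxx.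
  (* Independence of the representative: equal labels give equal types one level deeper, hence equal
     multisets of neighbour types. *)
  apply/eq_seq_msetP/(perm_map_inj val_inj); rewrite -!map_comp.
  rewrite -!nbr_types; have {}wv := stable w v (congr1 val wv).
  rewrite /nbr_type wv; apply: perm_map; exact: code_inj.
have outE v :
    mset_map l (out_termini v) = seq_mset [seq l (ftrm e) | e <- outs v].
  rewrite (map_comp l (@ftrm G)); apply/eq_seq_msetP; apply: perm_map.
  exact: perm_eq_seq_mset.
exists X, l, lp, M; split=> [v|]; last first.
  rewrite outE ME /nbrs /parents map_cat -map_comp.
  case: pickP => // e /eqP eR.
  by have := R_no_in e; rewrite eR eqxx.
have Mv :
    M (l (val v)) = (lp v +` seq_mset [seq l (ftrm e) | e <- outs (val v)]).
  rewrite ME -mset_cons /lp /nbrs /parents; case: pickP => [e _|no_in].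
    by rewrite /= -map_comp.
  by have [e ev] := has_in (valP v); have := no_in e; rewrite ev eqxx.
split.
- by rewrite Mv in_mset1D eqxx.
- by rewrite outE Mv msetD1K.
move=> e ev; rewrite /lp.
case: pickP => [f /eqP fv|/(_ e)]; last by rewrite ev eqxx.
by apply: l_inj; rewrite !vertex_type_org ev fv.
Qed.

End Labelling.

Theorem theorem1 (G : fin_graph) (R : vert G)
  (G_rooted : rooted R)
  (G_no_sink : forall v : vert G, ~ sink v)
  (R_no_in : forall e : edge G, trm e <> R)
  (G_conn : strongly_connected (del_vertex R))
  (G_nonred : non_redundant (del_vertex R))
  (G_noncirc : ~ circular (del_vertex R))
  (T_cocompact : cocompact (unfolding_tree R)) :
  has_actual_labelling R.
Proof.
pose path v := sval (cid (G_rooted v)).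
have pathP v : is_path_to R v (path v) by exact: svalP.
have path0 v p : v != R -> is_path_to R v p -> p != [::].
  by move=> vR [_ pv]; apply: contraNneq vR => p0; rewrite -pv p0.
have rcons_path e p :
    is_path_to R (org e) p -> is_path_to R (trm e) (rcons p e).
  by move=> [pP pe]; split; rewrite ?terminus_rcons // is_path_rcons pP pe eqxx.
have R_in e : trm e != R by apply/eqP/R_no_in.
apply: (@labelling_of_types _ _ (fun n v => back n (rev (path v)))).
- move=> n; case: (lastP (path R)) (pathP R) => // p e [_].
  by rewrite terminus_rcons => /R_no_in.
(* The path chosen for the terminus of [e] may be replaced by the one chosen for its origin followed
   by [e], whose back branch unfolds by definition. *)
- move=> n e; have [g gP g0] := loop_at G_no_sink R_no_in G_conn (R_in e).
  have eP := rcons_path (e : edge G) _ (pathP (forg e)).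
  have -> := back_unique T_cocompact n.+1 gP g0 (pathP (ftrm e)) eP
    (path0 _ _ (R_in e) (pathP _)) (path0 _ _ (R_in e) eP).
  by rewrite rev_rcons.
- by move=> n v; apply: trunc_back.
- exact: R_in.
move=> v vR; have [] := pathP v.
case: (lastP (path v)) (path0 v _ vR (pathP v)) => // p e _ _.
by rewrite terminus_rcons => <-; exists e.
Qed.
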